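(* Let $p$ be a prime with $p>2$ and let $k$ be a field of characteristic $p$. (a) Let $L$ be the $3$-dimensional restricted ($p$-nilpotent) Lie algebra over $k$ with basis $\{x_1,x_2,x_3\}$, the only non-zero bracket of basis elements being $[x_1,x_2]=x_3$ (up to antisymmetry), and with $p$-operation given by $x_i^{[p]}=0$ for $i=1,2,3$. Then the algebra C5 $=k\langle x,y,z\rangle/\langle [x,y]-z,[x,z],[y,z],x^p,y^p,z^p\rangle$ is isomorphic to the restricted enveloping algebra $U^{[p]}(L)$. (b) Let $L$ be the $3$-dimensional restricted Lie algebra over $k$ with basis $\{x_1,x_2,x_3\}$, the only non-zero bracket of basis elements being $[x_1,x_2]=x_3$ (up to antisymmetry), and with $p$-operation given by $x_1^{[p]}=x_3$ and $x_i^{[p]}=0$ for $i=2,3$. Then the algebra C6 $=k\langle x,y,z\rangle/\langle [x,y]-z,[x,z],[y,z],x^p-z,y^p,z^p\rangle$ is isomorphic to $U^{[p]}(L)$. (c) Let $L$ be the restricted Lie algebra $\mathfrak{sl}_2(k)$. Then the algebra C15 $=k\langle x,y,z\rangle/\langle [x,y]-z,[x,z]-x,[y,z]+y,x^p,y^p,z^p-z\rangle$ is isomorphic to $U^{[p]}(L)$.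
   Context: $k\langle x_1,\dots,x_n\rangle$ is the free associative algebra; in it $[a,b]=ab-ba$. A restricted Lie algebra over a field $k$ of characteristic $p$ is a Lie algebra $L$ with a $p$-operation $(-)^{[p]}\colon L\to L$ (in the sense of Jacobson). If $L$ has $k$-basis $\{x_1,\dots,x_n\}$, its restricted enveloping algebra is $$U^{[p]}(L)=k\langle x_1,\dots,x_n\rangle/\langle \{x_ix_j-x_jx_i-[x_i,x_j]\}_{i,j=1}^{n},\ \{x_i^p-x_i^{[p]}\}_{i=1}^n\rangle ,$$ where $[x_i,x_j]$ and $x_i^{[p]}$ are the elements of $L$ written as linear combinations of the basis. $\mathfrak{sl}_2(k)$ has basis $e_+,h,e_-$ with $[h,e_\pm]=\pm2e_\pm$, $[e_+,e_-]=h$, with its usual $p$-operation $e_\pm^{[p]}=0$, $h^{[p]}=h$. *)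

(* Defs.v *)
From HB Require Import structures.
From mathcomp Require Import all_boot all_order all_algebra.
From mathcomp Require Import boolp.
From mathcomp Require Import monalg.

Set Implicit Arguments.
Unset Strict Implicit.
Unset Printing Implicit Defensive.

Import GRing.Theory.
Local Open Scope ring_scope.
Local Open Scope quotient_scope.

(** The free monoid on [n] letters; its monoid algebra is the free associative
    algebra. *)
Definition word (n : nat) : Type := seq 'I_n.

HB.instance Definition _ n := Choice.on (word n).

Fact word_unit n (u v : word n) : u ++ v = [::] -> u = [::] /\ v = [::].
Proof. by case: u => //= ->. Qed.

HB.instance Definition _ n := Choice_isMonomialDef.Build (word n)
  (@catA _) (@cat0s _) (@cats0 _) (@word_unit n).

Definition freealg (k : fieldType) (n : nat) : Type := {malg k[word n]}.

Section FreeAlgebra.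
Variables (k : fieldType) (n : nat).

HB.instance Definition _ := GRing.Lalgebra.on (freealg k n).

Fact freealg_scalerAr (c : k) (a b : freealg k n) :
  c *: (a * b) = a * (c *: b).
Proof.
suff cC : (c%:MP : {malg k[word n]}) * a = a * c%:MP.
  by rewrite -!mul_malgC mulrA cC -mulrA.
rewrite !malgM_def fgmulUg fgmulgU; apply: eq_bigr => w _.
by rewrite mulrC mul1m mulm1.
Qed.

HB.instance Definition _ := GRing.Lalgebra_isAlgebra.Build k (freealg k n)
  freealg_scalerAr.

Definition freevar (i : 'I_n) : freealg k n := << ([:: i] : word n) >>.

End FreeAlgebra.

Arguments freevar {k n} i.

(** The two-sided ideal generated by [S]. *)
Inductive in_ideal (A : pzRingType) (S : seq A) : A -> Prop :=
| ideal_gen s of s \in S : in_ideal S s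
| ideal_zero : in_ideal S 0
| ideal_add a b of in_ideal S a & in_ideal S b : in_ideal S (a + b)
| ideal_mull a b of in_ideal S b : in_ideal S (a * b)
| ideal_mulr a b of in_ideal S a : in_ideal S (a * b).

Definition ideal (A : pzRingType) (S : seq A) : {pred A} :=
  [pred a | `[< in_ideal S a >]].

Section IdealQuotient.
Variables (k : fieldType) (A : algType k) (S : seq A).

Fact ideal_zmod_closed : zmod_closed (ideal S).
Proof.
split=> [|a b /asboolP Sa /asboolP Sb]; apply/asboolP; first exact: ideal_zero.
by apply: ideal_add => //; rewrite -mulN1r; apply: ideal_mull.
Qed.

HB.instance Definition _ :=
  GRing.isZmodClosed.Build A (ideal S) ideal_zmod_closed.

Definition quot_alg : Type := {ideal_quot (ideal S)}.

HB.instance Definition _ := GRing.Zmodule.on quot_alg.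

Definition quot_pi : A -> quot_alg := \pi_{ideal_quot (ideal S)}.

Lemma quot_piP a b : quot_pi a = quot_pi b <-> in_ideal S (a - b).
Proof.
rewrite /quot_pi; split=> [/eqP|Sab].
  by rewrite -Quotient.idealrBE => /asboolP.
by apply/eqP; rewrite -Quotient.idealrBE; apply/asboolP.
Qed.

Lemma quot_pi_surj (u : quot_alg) : exists a, u = quot_pi a.
Proof. by exists (repr u); rewrite /quot_pi reprK. Qed.

Fact quot_piD a b : quot_pi (a + b) = quot_pi a + quot_pi b.
Proof. by rewrite /quot_pi !piE. Qed.

Definition quot_one : quot_alg := quot_pi 1.
Definition quot_mul (u v : quot_alg) : quot_alg := quot_pi (repr u * repr v).
Definition quot_scale (c : k) (u : quot_alg) : quot_alg :=
  quot_pi (c *: repr u).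

Fact quot_piM a b : quot_pi (a * b) = quot_mul (quot_pi a) (quot_pi b).
Proof.
have rP c : in_ideal S (c - repr (quot_pi c)).
  by apply/quot_piP; rewrite /quot_pi reprK.
apply/quot_piP; set a' := repr _; set b' := repr _.
have -> : a * b - a' * b' = (a - a') * b + a' * (b - b').
  by rewrite mulrBl mulrBr addrA subrK.
by apply: ideal_add; [apply: ideal_mulr|apply: ideal_mull]; apply: rP.
Qed.

Fact quot_piZ c a : quot_pi (c *: a) = quot_scale c (quot_pi a).
Proof.
apply/quot_piP; rewrite -scalerBr -mulr_algl; apply: ideal_mull.
by apply/quot_piP; rewrite /quot_pi reprK.
Qed.

Fact quot_mulA : associative quot_mul.
Proof.
move=> u v w; have [a ->] := quot_pi_surj u; have [b ->] := quot_pi_surj v.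
by have [c ->] := quot_pi_surj w; rewrite -!quot_piM mulrA.
Qed.

Fact quot_mul1 : left_id quot_one quot_mul.
Proof.
by move=> u; have [a ->] := quot_pi_surj u; rewrite -quot_piM mul1r.
Qed.

Fact quot_1mul : right_id quot_one quot_mul.
Proof.
by move=> u; have [a ->] := quot_pi_surj u; rewrite -quot_piM mulr1.
Qed.

Fact quot_mulDl : left_distributive quot_mul +%R.
Proof.
move=> u v w; have [a ->] := quot_pi_surj u; have [b ->] := quot_pi_surj v.
have [c ->] := quot_pi_surj w.
by rewrite -quot_piD -!quot_piM -quot_piD mulrDl.
Qed.

Fact quot_mulDr : right_distributive quot_mul +%R.
Proof.
move=> u v w; have [a ->] := quot_pi_surj u; have [b ->] := quot_pi_surj v.
have [c ->] := quot_pi_surj w.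
by rewrite -quot_piD -!quot_piM -quot_piD mulrDr.
Qed.

HB.instance Definition _ := GRing.Zmodule_isPzRing.Build quot_alg
  quot_mulA quot_mul1 quot_1mul quot_mulDl quot_mulDr.

Fact quot_scaleA a b u : quot_scale a (quot_scale b u) = quot_scale (a * b) u.
Proof.
by have [x ->] := quot_pi_surj u; rewrite -!quot_piZ scalerA.
Qed.

Fact quot_scale1 : left_id 1 quot_scale.
Proof. by move=> u; have [x ->] := quot_pi_surj u; rewrite -quot_piZ scale1r. Qed.

Fact quot_scaleDr : right_distributive quot_scale +%R.
Proof.
move=> c u v; have [x ->] := quot_pi_surj u; have [y ->] := quot_pi_surj v.
by rewrite -quot_piD -!quot_piZ -quot_piD scalerDr.
Qed.

Fact quot_scaleDl u : {morph quot_scale^~ u : a b / a + b}.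
Proof.
move=> a b; have [x ->] := quot_pi_surj u.
by rewrite -!quot_piZ -quot_piD scalerDl.
Qed.

HB.instance Definition _ := GRing.Zmodule_isLmodule.Build k quot_alg
  quot_scaleA quot_scale1 quot_scaleDr quot_scaleDl.

Fact quot_pi_linear : linear quot_pi.
Proof. by move=> c a b; rewrite quot_piD quot_piZ. Qed.

Fact quot_pi_monoid_morphism : monoid_morphism quot_pi.
Proof. by split=> [|a b]; rewrite ?quot_piM. Qed.

HB.instance Definition _ := GRing.isLinear.Build k A quot_alg _ quot_pi
  quot_pi_linear.
HB.instance Definition _ := GRing.isMonoidMorphism.Build A quot_alg quot_pi
  quot_pi_monoid_morphism.

Fact quot_scalerAl (c : k) (u v : quot_alg) : c *: (u * v) = (c *: u) * v.
Proof.
have [a ->] := quot_pi_surj u; have [b ->] := quot_pi_surj v.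
by rewrite -rmorphM -!linearZ -rmorphM /= scalerAl.
Qed.

Fact quot_scalerAr (c : k) (u v : quot_alg) : c *: (u * v) = u * (c *: v).
Proof.
have [a ->] := quot_pi_surj u; have [b ->] := quot_pi_surj v.
by rewrite -rmorphM -!linearZ -rmorphM /= scalerAr.
Qed.

End IdealQuotient.

(** Isomorphism of [k]-algebras. A quotient may be the zero ring, so it is not
    an [algType]: its algebra structure is the join of an [lmodType k] and a
    [pzRingType], with [quot_scalerAl] and [quot_scalerAr]. *)
Notation "A \isoalg B" :=
  (exists f : A -> B, [/\ linear f, monoid_morphism f & bijective f])
  (at level 70, no associativity) : type_scope.

HB.mixin Record isLieAlgebra (k : fieldType) L of GRing.Lmodule k L := {
  lie : L -> L -> L;
  lie_linearl : forall y, linear (lie^~ y);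
  lie_linearr : forall x, linear (lie x);
  liexx : forall x, lie x x = 0;
  lie_jacobi : forall x y z,
    lie x (lie y z) + lie y (lie z x) + lie z (lie x y) = 0
}.

#[short(type="lieAlgType")]
HB.structure Definition LieAlgebra (k : fieldType) :=
  {L of Vector k L & isLieAlgebra k L}.

(** [i * jacobson_s p i x y] is the coefficient of [t ^ (i - 1)] in
    [ad (t x + y) ^ (p - 1) (x)]: the letter [true] of a word [w] stands for
    the summand [t x] of [t x + y], the letter [false] for [y]. *)
Definition jacobson_s (k : fieldType) (L : lieAlgType k) (p i : nat)
    (x y : L) : L :=
  (i%:R : k)^-1 *:
    \sum_(w : p.-1.-tuple bool | count id w == i.-1)
       foldr (fun b z => lie (if b then x else y) z) x w.

HB.mixin Record isRestrictedLie (p : nat) (k : fieldType) L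
    of LieAlgebra k L := {
  ppow : L -> L;
  ppowZ : forall (c : k) x, ppow (c *: x) = c ^+ p *: ppow x;
  lie_ppow : forall x y, lie (ppow x) y = iter p (lie x) y;
  ppowD : forall x y,
    ppow (x + y) = ppow x + ppow y + \sum_(1 <= i < p) jacobson_s p i x y
}.

(** Only meaningful when [p] is the characteristic of [k]. *)
#[short(type="restrictedLieType")]
HB.structure Definition RestrictedLie (p : nat) (k : fieldType) :=
  {L of LieAlgebra k L & isRestrictedLie p k L}.

Section RestrictedEnveloping.
Variables (p : nat) (k : fieldType) (L : restrictedLieType p k).
Variables (n : nat) (X : n.-tuple L).

(** [v] as a linear combination of the basis [X], in the free algebra. *)
Definition env_lin (v : L) : freealg k n :=
  \sum_(i < n) coord X i v *: freevar i.

Definition env_rels : seq (freealg k n) :=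
  [seq freevar i * freevar j - freevar j * freevar i
         - env_lin (lie (tnth X i) (tnth X j))
     | i <- enum 'I_n, j <- enum 'I_n] ++
  [seq freevar i ^+ p - env_lin (ppow (tnth X i)) | i <- enum 'I_n].

(** The restricted enveloping algebra presented on [X], to be used when [X] is
    a basis of [L]. *)
Definition res_env : Type := quot_alg env_rels.

HB.instance Definition _ := GRing.PzRing.on res_env.
HB.instance Definition _ := GRing.Lmodule.on res_env.

End RestrictedEnveloping.

Definition acomm (A : pzRingType) (a b : A) : A := a * b - b * a.

Section Presentations.
Variables (p : nat) (k : fieldType).

Let x : freealg k 3 := freevar 0.
Let y : freealg k 3 := freevar 1.
Let z : freealg k 3 := freevar 2.

Definition C5 : Type :=
  quot_alg [:: acomm x y - z; acomm x z; acomm y z; x ^+ p; y ^+ p; z ^+ p].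

Definition C6 : Type :=
  quot_alg [:: acomm x y - z; acomm x z; acomm y z; x ^+ p - z; y ^+ p; z ^+ p].

Definition C15 : Type :=
  quot_alg [:: acomm x y - z; acomm x z - x; acomm y z + y;
               x ^+ p; y ^+ p; z ^+ p - z].

HB.instance Definition _ := GRing.PzRing.on C5.
HB.instance Definition _ := GRing.Lmodule.on C5.
HB.instance Definition _ := GRing.PzRing.on C6.
HB.instance Definition _ := GRing.Lmodule.on C6.
HB.instance Definition _ := GRing.PzRing.on C15.
HB.instance Definition _ := GRing.Lmodule.on C15.

End Presentations.

Lemma basis3 (k : fieldType) (V : vectType k) (x1 x2 x3 : V) :
  (forall v, exists a b c : k, v = a *: x1 + b *: x2 + c *: x3) ->
  (forall a b c : k, a *: x1 + b *: x2 + c *: x3 = 0 ->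
     [/\ a = 0, b = 0 & c = 0]) ->
  basis_of fullv [tuple x1; x2; x3].
Proof.
move=> spX freeX; apply/andP; split.
  rewrite eqEsubv subvf /=; apply/subvP => v _.
  have [a [b [c ->]]] := spX v.
  by rewrite !rpredD ?rpredZ // memv_span // !inE eqxx ?orbT.
apply/freeP => c; rewrite !big_ord_recl big_ord0 addr0 /= addrA.
move=> /freeX[c0 c1 c2] i.
case: i => [[|[|[|//]]] lti].
- by rewrite -c0; congr (c _); apply: val_inj.
- by rewrite -c1; congr (c _); apply: val_inj.
- by rewrite -c2; congr (c _); apply: val_inj.
Qed.

Section AssociativeJacobson.
Variables (p : nat) (k : fieldType) (chk : p \in [pchar k]).

Lemma pchar_alg (A : algType k) : p \in [pchar A].
Proof.
have := chk; rewrite !inE => /andP[-> /eqP p0] /=.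
by rewrite -scaler_nat p0 scale0r.
Qed.

Lemma acomm_jacobi (A : pzRingType) (a b c : A) :
  acomm a (acomm b c) + acomm b (acomm c a) + acomm c (acomm a b) = 0.
Proof.
have E (x1 x2 x3 x4 x5 x6 : A) : x1 - x2 - (x3 - x4) + (x3 - x5 - (x6 - x2))
    + (x6 - x4 - (x1 - x5)) = 0.
  have F (x y z : A) : (x - y) + (y - z) + (z - x) = 0.
    by rewrite subrKA subrKA subrr.
  have G (x y z t : A) : x - y - (z - t) = (x - z) + (t - y).
    by rewrite opprB [t - z]addrC addrACA [- y + t]addrC.
  rewrite (G x1) (G x3) (G x6) (addrACA (x1 - x3)).
  by rewrite (addrACA (x1 - x3 + _)) !F addr0.
rewrite /acomm !(mulrBl, mulrBr) !mulrA; exact: E.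
Qed.

Lemma iter_acomm (A : pzRingType) (P z : A) n :
  iter n (acomm P) z
    = \sum_(i < n.+1) (-1) ^+ i * 'C(n, i)%:R * (P ^+ (n - i) * z * P ^+ i).
Proof.
elim: n => [|n IHn].
  by rewrite big_ord_recl big_ord0 /= !expr0 bin0 !mul1r !mulr1 addr0.
have comN i m (u : A) : GRing.comm u ((-1) ^+ i * m%:R).
  by apply: commrM; [apply: commr_sign|apply: commr_nat].
rewrite iterS IHn /acomm.
rewrite mulr_sumr mulr_suml big_ord_recl [X in _ - X]big_ord_recr /=.
rewrite [RHS]big_ord_recl [X in _ = _ + X]big_ord_recr /=.
rewrite opprD -!addrA; congr (_ + _).
  by rewrite !expr0 !bin0 !mulr1 !mul1r !subn0 mulrA exprS.
rewrite addrA -sumrB; congr (_ + _).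
  apply: eq_bigr => i _; rewrite /bump /= add1n.
  rewrite subSS binS natrD mulrDr mulrDl; congr (_ + _).
    rewrite mulrA comN -mulrA; congr (_ * _).
    by rewrite !mulrA -exprS -subSn.
  by rewrite exprS mulN1r !mulNr -!mulrA -exprSr.
rewrite /bump /= add1n !binn !mulr1 !subnn !expr0 !mul1r.
by rewrite exprS mulN1r mulNr -!mulrA -exprSr.
Qed.

Lemma iter_acomm_p (A : nzRingType) (chA : p \in [pchar A]) (P z : A) :
  iter p (acomm P) z = acomm (P ^+ p) z.
Proof.
have pr_p := pcharf_prime chA.
have p_gt0 := prime_gt0 pr_p.
rewrite iter_acomm -(prednK p_gt0) big_ord_recl big_ord_recr /= prednK //.
rewrite big1 => [|i _].
  rewrite add0r /acomm /bump /= add1n prednK // subn0 subnn bin0 binn !expr0.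
  rewrite !mulr1 !mul1r; congr (_ + _).
  by have:= pFrobenius_autN chA 1; rewrite !pFrobenius_autE expr1n => ->; rewrite mulN1r.
have ip : (i.+1 < p)%N by rewrite -{2}(prednK p_gt0) ltnS.
rewrite /bump /= add1n; have /dvdnP[q ->] := prime_dvd_bin pr_p (ip : 0 < i.+1 < p)%N.
by rewrite natrM (pcharf0 chA) !mulr0 mul0r.
Qed.

Lemma iter_acomm_pred (A : nzRingType) (chA : p \in [pchar A]) (P z : A) :
  iter p.-1 (acomm P) z = \sum_(i < p) P ^+ (p.-1 - i) * z * P ^+ i.
Proof.
have pr_p := pcharf_prime chA.
have p_gt0 := prime_gt0 pr_p.
rewrite iter_acomm prednK //; apply: eq_bigr => -[i ip] _ /=.
suff -> : (-1) ^+ i * 'C(p.-1, i)%:R = 1 :> A by rewrite mul1r.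
elim: i ip => [|i IHi] ip; first by rewrite bin0 expr0 mulr1.
have := prime_dvd_bin pr_p (ip : 0 < i.+1 < p)%N.
rewrite -[X in 'C(X, _)](prednK p_gt0) binS => /dvdnP[q Eq].
have : ('C(p.-1, i.+1) + 'C(p.-1, i))%:R = 0 :> A.
  by rewrite Eq natrM (pcharf0 chA) mulr0.
rewrite natrD => /eqP; rewrite addr_eq0 => /eqP ->.
by rewrite exprS mulN1r mulrNN IHi // ltnW.
Qed.

Lemma deriv_exp_nc (A : nzRingType) (P : {poly A}) n :
  (P ^+ n)^`() = \sum_(i < n) P ^+ (n.-1 - i) * P^`() * P ^+ i.
Proof.
elim: n => [|n IHn]; first by rewrite big_ord0 expr0 -polyC1 derivC.
rewrite exprS derivM big_ord_recr /= subnn expr0 mul1r addrC; congr (_ + _).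
rewrite IHn mulr_sumr; apply: eq_bigr => i _; rewrite !mulrA -exprS.
by congr (_ ^+ _ * _ * _); case: n i {IHn} => [[]//|n] i; rewrite /= -subSn // -ltnS.
Qed.

Lemma iter_acomm_poly (A : nzRingType) (x y : A) n :
  iter n (acomm (x *: 'X + y%:P)) x%:P
    = \sum_(w : n.-tuple bool)
        foldr (fun b z => acomm (if b then x else y) z) x w *: 'X^(count id w).
Proof.
elim: n => [|n IHn].
  rewrite (bigD1 [tuple]) //= big1 ?addr0 => [|w].
    by rewrite expr0 alg_polyC.
  by rewrite tuple0.
rewrite iterS IHn.
rewrite (reindex (fun bw : bool * n.-tuple bool => [tuple of bw.1 :: bw.2])) /=;
  last first.
  exists (fun w : n.+1.-tuple bool => (thead w, [tuple of behead w])) => w _.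
    by case: w => b w /=; congr (_, _); apply: val_inj.
  by rewrite [w in RHS]tuple_eta; apply: val_inj.
rewrite -(pair_bigA _ (fun b (w : n.-tuple bool) => acomm (if b then x else y)
  (foldr (fun b z => acomm (if b then x else y) z) x w)
    *: 'X^(b + count id w))) /= big_bool /=.
rewrite -big_split /= /acomm mulr_sumr mulr_suml -sumrB; apply: eq_bigr => w _.
set f := foldr _ _ _; set m := count id w.
have XM (a b : A) i j : (a *: 'X^i) * (b *: 'X^j) = (a * b) *: 'X^(i + j).
  rewrite -!mul_polyC polyCM -!mulrA; congr (_ * _).
  by rewrite mulrA -(commr_polyXn b%:P i) -mulrA -exprD.
rewrite mulrDl mulrDr opprD addrACA add1n add0n !scalerBl; congr (_ + _).
  by rewrite -['X]expr1 !XM add1n addn1.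
by rewrite -[y%:P]alg_polyC -[1](expr0 'X) !XM add0n addn0.
Qed.

Lemma assoc_jacobson (A : algType k) (x y : A) :
  (x + y) ^+ p = x ^+ p + y ^+ p +
    \sum_(1 <= i < p) (i%:R : k)^-1 *:
      \sum_(w : p.-1.-tuple bool | count id w == i.-1)
        foldr (fun b z => acomm (if b then x else y) z) x w.
Proof.
have chA := pchar_alg A; have pr_p := pcharf_prime chA.
have p_gt0 := prime_gt0 pr_p.
pose P : {poly A} := x *: 'X + y%:P.
have PS (q : {poly A}) m : (P * q)`_m.+1 = x * q`_m + y * q`_m.+1.
  by rewrite mulrDl coefD -mul_polyC -mulrA !coefCM coefXM.
have szP n : (size (P ^+ n) <= n.+1)%N.
  apply/leq_sizeP; elim: n => [|n IHn] [|j] // ltnj.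
    by rewrite expr0 coef1.
  by rewrite exprS PS !IHn ?mulr0 ?addr0 // ltnW.
have topP n : (P ^+ n)`_n = x ^+ n.
  elim: n => [|n IHn]; first by rewrite !expr0 coef1.
  rewrite [in LHS]exprS PS IHn -exprS.
  by rewrite [_`_n.+1]nth_default ?mulr0 ?addr0.
have botP : (P ^+ p)`_0 = y ^+ p.
  elim: (p) => [|n IHn]; first by rewrite !expr0 coef1.
  by rewrite [in LHS]exprS coef0M IHn coefD coefZ coefX mulr0 add0r coefC -exprS.
have midP i : (0 < i < p)%N -> (P ^+ p)`_i = (i%:R : k)^-1 *:
      \sum_(w : p.-1.-tuple bool | count id w == i.-1)
        foldr (fun b z => acomm (if b then x else y) z) x w.
  case: i => // i ip.
  have i0 : (i.+1%:R : k) != 0.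
    rewrite -(dvdn_pcharf chk); apply: contraL ip.
    by rewrite -leqNgt => /dvdn_leq ->.
  apply: (scalerI i0); rewrite scalerA mulfV // scale1r scaler_nat -coef_deriv.
  rewrite deriv_exp_nc.
  have -> : P^`() = x%:P.
    by rewrite derivD derivZ derivX derivC addr0 alg_polyC.
  have chP : p \in [pchar {poly A}].
    have := chA; rewrite !inE => /andP[-> /eqP p0] /=.
    by rewrite -polyC_natr p0.
  rewrite -iter_acomm_pred // iter_acomm_poly coef_sum [RHS]big_mkcond /=.
  apply: eq_bigr => w _; rewrite coefZ coefXn eq_sym.
  by case: eqP; rewrite ?mulr1 ?mulr0.
transitivity (P ^+ p).[1].
  have -> : x + y = P.[1] by rewrite hornerD hornerZ hornerX hornerC mulr1.
  by rewrite horner_exp_comm // /comm_poly mulr1 mul1r.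
rewrite (@horner_coef_wide _ p.+1) //.
under eq_bigr do rewrite expr1n mulr1.
rewrite -(big_mkord xpredT (fun i => (P ^+ p)`_i)) big_nat_recr //= big_ltn //.
rewrite botP topP addrAC [y ^+ p + _]addrC; congr (_ + _).
by apply: eq_big_nat => i; apply: midP.
Qed.
End AssociativeJacobson.

Definition mx2_trace (k : fieldType) (M : 'M[k]_2) : k^o := \tr M.

Fact mx2_trace_linear (k : fieldType) : linear (@mx2_trace k).
Proof. by move=> c M N; rewrite /mx2_trace mxtraceD mxtraceZ. Qed.

HB.instance Definition _ (k : fieldType) :=
  GRing.isLinear.Build k 'M[k]_2 k^o _ (@mx2_trace k) (@mx2_trace_linear k).

Definition sl2_space (k : fieldType) : {vspace 'M[k]_2} :=
  lker (linfun (@mx2_trace k)).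

(** The traceless matrices, with the commutator as bracket and the matrix power
    [M ^+ p] as [p]-operation. *)
Definition sl2 (k : fieldType) (p : nat) (chk : p \in [pchar k]) : Type :=
  subvs_of (sl2_space k).

Section SL2.
Variables (k : fieldType) (p : nat) (chk : p \in [pchar k]).

HB.instance Definition _ := Vector.on (sl2 chk).

Notation L := (sl2 chk).

Lemma sl2P (M : 'M[k]_2) : (M \in sl2_space k) = (\tr M == 0).
Proof. by rewrite memv_ker lfunE. Qed.

Definition sl2_val (u : L) : 'M[k]_2 := vsval u.
Definition sl2_mk (M : 'M[k]_2) : L := vsproj (sl2_space k) M.

Lemma sl2_valK (u : L) : sl2_mk (sl2_val u) = u.
Proof. exact: vsvalK. Qed.

Lemma sl2_mkK (M : 'M[k]_2) : \tr M = 0 -> sl2_val (sl2_mk M) = M.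
Proof. by move=> M0; apply: vsprojK; rewrite sl2P M0. Qed.

Lemma sl2_val_inj : injective sl2_val.
Proof. exact: can_inj sl2_valK. Qed.

Lemma sl2_tr (u : L) : \tr (sl2_val u) = 0.
Proof. by apply/eqP; rewrite -sl2P; apply: subvsP. Qed.

Fact sl2_val_linear : linear sl2_val.
Proof. by move=> c u v; rewrite /sl2_val linearP. Qed.

HB.instance Definition _ := GRing.isLinear.Build k L 'M[k]_2 _ sl2_val
  sl2_val_linear.

Definition sl2_lie (u v : L) : L := sl2_mk (acomm (sl2_val u) (sl2_val v)).
Definition sl2_ppow (u : L) : L := sl2_mk (sl2_val u ^+ p).

Lemma sl2_lieE u v : sl2_val (sl2_lie u v) = acomm (sl2_val u) (sl2_val v).
Proof. by apply: sl2_mkK; rewrite /acomm raddfB /= mxtrace_mulC subrr. Qed.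

Lemma tr0_sqr (M : 'M[k]_2) : \tr M = 0 -> exists d : k, M ^+ 2 = d%:M.
Proof.
rewrite /mxtrace !big_ord_recl big_ord0 addr0 => /eqP.
rewrite addrC addr_eq0 => /eqP M11.
exists (M ord0 ord0 ^+ 2 + M ord0 (lift ord0 ord0) * M (lift ord0 ord0) ord0).
have dich (i : 'I_2) : i = ord0 \/ i = lift ord0 ord0.
  by case: i => [[|[|//]] ?]; [left|right]; apply: val_inj.
apply/matrixP => i j; rewrite !mxE !big_ord_recl big_ord0 addr0.
case: (dich i) => ->; case: (dich j) => -> /=; rewrite ?M11 ?mulr1n ?mulr0n //.
- by rewrite mulrN (mulrC (M ord0 ord0)) subrr.
- by rewrite mulNr (mulrC (M ord0 ord0)) subrr.
- by rewrite mulrNN addrC -expr2 (mulrC (M (lift _ _) _)).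
Qed.

Lemma tr0_exp (M : 'M[k]_2) : \tr M = 0 -> \tr (M ^+ p) = 0.
Proof.
move=> M0; have [d Md] := tr0_sqr M0.
have [p2 | odd_p] := even_prime (pcharf_prime chk).
  rewrite p2 Md mxtrace_scalar -mulr_natl -p2.
  by rewrite (pcharf0 chk) mul0r.
rewrite -(odd_double_half p) odd_p exprD expr1 -mul2n exprM Md.
have -> : (d%:M : 'M[k]_2) ^+ p./2 = (d ^+ p./2)%:M by rewrite -rmorphXn.
by rewrite -[_ * _]/(_ *m _) mul_mx_scalar mxtraceZ M0 mulr0.
Qed.

Lemma sl2_ppowE u : sl2_val (sl2_ppow u) = sl2_val u ^+ p.
Proof. by apply/sl2_mkK/tr0_exp/sl2_tr. Qed.

Fact sl2_lie_linearl v : linear (sl2_lie^~ v).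
Proof.
move=> c u1 u2; apply: sl2_val_inj; rewrite linearP /= !sl2_lieE linearP /=.
rewrite /acomm mulrDl mulrDr opprD addrACA -scalerAl -scalerAr.
by rewrite scalerBr.
Qed.

Fact sl2_liexx u : sl2_lie u u = 0.
Proof. by apply: sl2_val_inj; rewrite sl2_lieE linear0 /acomm subrr. Qed.

Fact sl2_lie_linearr u : linear (sl2_lie u).
Proof.
move=> c v1 v2; apply: sl2_val_inj; rewrite linearP /= !sl2_lieE linearP /=.
rewrite /acomm mulrDl mulrDr opprD addrACA -scalerAl -scalerAr.
by rewrite scalerBr.
Qed.

Fact sl2_jacobi u v w :
  sl2_lie u (sl2_lie v w) + sl2_lie v (sl2_lie w u) + sl2_lie w (sl2_lie u v)
    = 0.
Proof.
apply: sl2_val_inj; rewrite linear0 !linearD /= !sl2_lieE /acomm.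
exact: acomm_jacobi.
Qed.

Lemma sl2_iter_lie u v n :
  sl2_val (iter n (sl2_lie u) v) = iter n (acomm (sl2_val u)) (sl2_val v).
Proof. by elim: n => //= n <-; rewrite sl2_lieE. Qed.

HB.instance Definition _ := isLieAlgebra.Build k L
  sl2_lie_linearl sl2_lie_linearr sl2_liexx sl2_jacobi.

Fact sl2_ppowZ (c : k) (u : L) : sl2_ppow (c *: u) = c ^+ p *: sl2_ppow u.
Proof.
by apply: sl2_val_inj; rewrite linearZ /= !sl2_ppowE linearZ /= exprZn.
Qed.

Fact sl2_lie_ppow (u v : L) : lie (sl2_ppow u) v = iter p (lie u) v.
Proof.
apply: sl2_val_inj; rewrite sl2_lieE sl2_ppowE sl2_iter_lie.
by rewrite iter_acomm_p // pchar_alg.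
Qed.

Fact sl2_ppowD (u v : L) :
  sl2_ppow (u + v)
    = sl2_ppow u + sl2_ppow v + \sum_(1 <= i < p) jacobson_s p i u v.
Proof.
apply: sl2_val_inj; rewrite !linearD linear_sum /= !sl2_ppowE linearD /=.
rewrite (assoc_jacobson chk); congr (_ + _); apply: eq_bigr => i _.
congr (_ *: _); rewrite linear_sum /=; apply: eq_bigr => w _.
elim: (tval w) => //= b s ->; rewrite -[RHS]/(sl2_val (sl2_lie _ _)) sl2_lieE.
by case: b.
Qed.

HB.instance Definition _ := isRestrictedLie.Build p k L
  sl2_ppowZ sl2_lie_ppow sl2_ppowD.

Definition sl2_e : L := sl2_mk (delta_mx 0 1).
Definition sl2_h : L := sl2_mk (delta_mx 0 0 - delta_mx 1 1).
Definition sl2_f : L := sl2_mk (delta_mx 1 0).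

Lemma sl2_eE : sl2_val sl2_e = delta_mx 0 1.
Proof. by apply: sl2_mkK; rewrite /mxtrace !big_ord_recl big_ord0 !mxE !addr0. Qed.

Lemma sl2_hE : sl2_val sl2_h = delta_mx 0 0 - delta_mx 1 1.
Proof.
apply: sl2_mkK; rewrite /mxtrace !big_ord_recl big_ord0 !mxE /=.
by rewrite subr0 addr0 sub0r subrr.
Qed.

Lemma sl2_fE : sl2_val sl2_f = delta_mx 1 0.
Proof. by apply: sl2_mkK; rewrite /mxtrace !big_ord_recl big_ord0 !mxE !addr0. Qed.

Lemma sl2_basisP : basis_of fullv [tuple sl2_e; sl2_h; sl2_f].
Proof.
have comb (a b c : k) : sl2_val (a *: sl2_e + b *: sl2_h + c *: sl2_f)
    = \matrix_(i, j) (if i == 0 then if j == 0 then b else a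
                      else if j == 0 then c else - b).
  rewrite !linearD !linearZ /= sl2_eE sl2_hE sl2_fE.
  apply/matrixP => i j; rewrite !mxE.
  by case: i => [[|[|//]] ?]; case: j => [[|[|//]] ?] /=;
    rewrite ?(mulr0, mulr1, subr0, sub0r, mulrN, addr0, add0r).
apply: basis3 => [u|a b c /(congr1 sl2_val)].
  exists (sl2_val u 0 1), (sl2_val u 0 0), (sl2_val u 1 0).
  apply: sl2_val_inj; rewrite comb; apply/matrixP => i j; rewrite mxE.
  have := sl2_tr u; rewrite /mxtrace !big_ord_recl big_ord0 addr0 => /eqP.
  rewrite addrC addr_eq0 => /eqP u11.
  case: i => [[|[|//]] lti]; case: j => [[|[|//]] ltj] //=.
  - by congr (sl2_val u _ _); apply: val_inj.
  - by congr (sl2_val u _ _); apply: val_inj.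
  - by congr (sl2_val u _ _); apply: val_inj.
  rewrite -[0]/(ord0 : 'I_2) -u11.
  by congr (sl2_val u _ _); apply: val_inj.
rewrite comb linear0 => /matrixP M0.
by split; [have := M0 0 1|have := M0 0 0|have := M0 1 0]; rewrite !mxE.
Qed.

Lemma sl2_he : lie sl2_h sl2_e = 2%:R *: sl2_e.
Proof.
apply: sl2_val_inj; rewrite sl2_lieE linearZ /= sl2_eE sl2_hE.
apply/matrixP => i j; rewrite !mxE !big_ord_recl !big_ord0 !mxE.
by case: i => [[|[|//]] ?]; case: j => [[|[|//]] ?] /=;
  rewrite ?(mulr0, mul0r, mulr1, subr0, sub0r, mulrN, mulNr, addr0, add0r,
            opprK, oppr0).
Qed.

Lemma sl2_hf : lie sl2_h sl2_f = - 2%:R *: sl2_f.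
Proof.
apply: sl2_val_inj; rewrite sl2_lieE linearZ /= sl2_fE sl2_hE.
apply/matrixP => i j; rewrite !mxE !big_ord_recl !big_ord0 !mxE.
by case: i => [[|[|//]] ?]; case: j => [[|[|//]] ?] /=;
  rewrite ?(mulr0, mul0r, mulr1, subr0, sub0r, mulrN, mulNr, addr0, add0r,
            opprK, oppr0, opprD).
Qed.

Lemma sl2_ef : lie sl2_e sl2_f = sl2_h.
Proof.
apply: sl2_val_inj; rewrite sl2_lieE /= sl2_fE sl2_hE sl2_eE.
apply/matrixP => i j; rewrite !mxE !big_ord_recl !big_ord0 !mxE.
by case: i => [[|[|//]] ?]; case: j => [[|[|//]] ?] /=;
  rewrite ?(mulr0, mul0r, mulr1, subr0, sub0r, mulrN, mulNr, addr0, add0r,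
            opprK, oppr0, opprD).
Qed.

Lemma sl2_e_ppow : ppow sl2_e = 0.
Proof.
apply: sl2_val_inj; rewrite sl2_ppowE linear0 sl2_eE.
rewrite -(subnKC (prime_gt1 (pcharf_prime chk))) exprD.
by rewrite expr2 -[_ * _ in X in X * _]/(_ *m _) mul_delta_mx_0 // mul0r.
Qed.

Lemma sl2_f_ppow : ppow sl2_f = 0.
Proof.
apply: sl2_val_inj; rewrite sl2_ppowE linear0 sl2_fE.
rewrite -(subnKC (prime_gt1 (pcharf_prime chk))) exprD.
by rewrite expr2 -[_ * _ in X in X * _]/(_ *m _) mul_delta_mx_0 // mul0r.
Qed.

Lemma sl2_h_ppow : ppow sl2_h = sl2_h.
Proof.
apply: sl2_val_inj; rewrite sl2_ppowE sl2_hE.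
have chM : p \in [pchar 'M[k]_2] := pchar_alg chk 'M[k]_2.
have idem (i : 'I_2) n : (0 < n)%N -> (delta_mx i i : 'M[k]_2) ^+ n = delta_mx i i.
  case: n => // n _; elim: n => // n IHn.
  by rewrite exprS IHn -[LHS]/(_ *m _) mul_delta_mx.
have D01 : (delta_mx 0 0 : 'M[k]_2) * delta_mx 1 1 = 0.
  by rewrite -[LHS]/(_ *m _) mul_delta_mx_0.
have D10 : (delta_mx 1 1 : 'M[k]_2) * delta_mx 0 0 = 0.
  by rewrite -[LHS]/(_ *m _) mul_delta_mx_0.
have := pFrobenius_autB_comm chM (etrans D01 (esym D10)).
by rewrite !pFrobenius_autE !idem // prime_gt0 // (pcharf_prime chk).
Qed.

End SL2.

(** The [p]-operation given on the basis by [x1^[p] = c x3] and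
    [x2^[p] = x3^[p] = 0] extends to all vectors as [heis_ppow]; the cases
    [c = 0] and [c = 1] are those of [C5] and [C6]. *)
Definition heis (k : fieldType) (p : nat) (chk : p \in [pchar k])
  (p_gt2 : (2 < p)%N) (c : k) : Type := 'rV[k]_3.

Section Heisenberg.
Variables (k : fieldType) (p : nat) (chk : p \in [pchar k]).
Variables (p_gt2 : (2 < p)%N) (c : k).

HB.instance Definition _ := Vector.on (heis chk p_gt2 c).

Notation L := (heis chk p_gt2 c).

Definition heis_x (i : 'I_3) : L := delta_mx 0 i : 'rV[k]_3.
Definition heis_co (u : L) (i : 'I_3) : k := (u : 'rV[k]_3) 0 i.

Fact heis_coP a u v i :
  heis_co (a *: u + v) i = a * heis_co u i + heis_co v i.
Proof. by rewrite /heis_co !mxE. Qed.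

Fact heis_coZ a u i : heis_co (a *: u) i = a * heis_co u i.
Proof. by rewrite /heis_co !mxE. Qed.

Fact heis_coD u v i : heis_co (u + v) i = heis_co u i + heis_co v i.
Proof. by rewrite /heis_co !mxE. Qed.

Fact heis_co_x i j : heis_co (heis_x i) j = (j == i)%:R.
Proof. by rewrite /heis_co !mxE. Qed.

Definition heis_lie (u v : L) : L :=
  (heis_co u 0 * heis_co v 1 - heis_co u 1 * heis_co v 0) *: heis_x 2.
Definition heis_ppow (u : L) : L := (c * heis_co u 0 ^+ p) *: heis_x 2.

Fact heis_lie_linearl v : linear (heis_lie^~ v).
Proof.
move=> a u1 u2; rewrite /heis_lie !heis_coP scalerA -scalerDl; congr (_ *: _).
by rewrite !mulrDl opprD addrACA mulrBr !mulrA.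
Qed.

Fact heis_lie_linearr u : linear (heis_lie u).
Proof.
move=> a v1 v2; rewrite /heis_lie !heis_coP scalerA -scalerDl; congr (_ *: _).
rewrite !mulrDr opprD addrACA; congr (_ + _).
by rewrite mulrN [_ * (a * _)]mulrCA; congr (_ - _); rewrite mulrCA.
Qed.

Fact heis_liexx u : heis_lie u u = 0.
Proof. by rewrite /heis_lie mulrC subrr scale0r. Qed.

Fact heis_lie2 u v w : heis_lie u (heis_lie v w) = 0.
Proof.
by rewrite /heis_lie !heis_coZ !heis_co_x /= !mulr0 subrr scale0r.
Qed.

Fact heis_jacobi u v w :
  heis_lie u (heis_lie v w) + heis_lie v (heis_lie w u)
    + heis_lie w (heis_lie u v) = 0.
Proof. by rewrite !heis_lie2 !addr0. Qed.

HB.instance Definition _ := isLieAlgebra.Build k L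
  heis_lie_linearl heis_lie_linearr heis_liexx heis_jacobi.

Fact heis_ppowZ (a : k) (u : L) : heis_ppow (a *: u) = a ^+ p *: heis_ppow u.
Proof. by rewrite /heis_ppow heis_coZ exprMn scalerA mulrCA. Qed.

Fact heis_lie_ppow (u v : L) : lie (heis_ppow u) v = iter p (lie u) v.
Proof.
rewrite -(subnKC p_gt2) /= [RHS]heis_lie2 -[LHS]/(heis_lie _ _) /heis_lie.
by rewrite !heis_coZ !heis_co_x /= !mulr0 !mul0r subrr scale0r.
Qed.

Fact heis_ppowD (u v : L) :
  heis_ppow (u + v)
    = heis_ppow u + heis_ppow v + \sum_(1 <= i < p) jacobson_s p i u v.
Proof.
rewrite big1 => [|i _].
  rewrite addr0 /heis_ppow heis_coD -scalerDl -mulrDr; congr ((_ * _) *: _).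
  by have := pFrobenius_autD_comm chk (mulrC (heis_co u 0) (heis_co v 0));
    rewrite !pFrobenius_autE.
rewrite /jacobson_s big1 ?scaler0 // => -[w /= /eqP sz_w] _.
have : (1 < size w)%N by rewrite sz_w -ltnS prednK // ltnW // ltnW.
by case: w {sz_w} => [|b1 [|b2 w]] //= _; apply: heis_lie2.
Qed.

HB.instance Definition _ := isRestrictedLie.Build p k L
  heis_ppowZ heis_lie_ppow heis_ppowD.

Lemma heis_basisP : basis_of fullv [tuple heis_x 0; heis_x 1; heis_x 2].
Proof.
have comb (a1 a2 a3 : k) (i : 'I_3) :
    heis_co (a1 *: heis_x 0 + a2 *: heis_x 1 + a3 *: heis_x 2) i
      = if i == 0 then a1 else if i == 1 then a2 else a3.
  rewrite !heis_coD !heis_coZ !heis_co_x.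
  by case: i => [[|[|[|//]]] ?] /=; rewrite ?(mulr0, mulr1, addr0, add0r).
apply: basis3 => [u|a1 a2 a3 E0].
  exists (heis_co u 0), (heis_co u 1), (heis_co u 2).
  apply/rowP => i; rewrite -[LHS]/(heis_co _ _) -[RHS]/(heis_co _ _) comb.
  by case: i => [[|[|[|//]]] ?] /=; congr (heis_co _ _); apply: val_inj.
have C0 i : heis_co (0 : L) i = 0 by rewrite /heis_co mxE.
split; [have := comb a1 a2 a3 0|have := comb a1 a2 a3 1
       |have := comb a1 a2 a3 2]; by rewrite E0 C0.
Qed.

Lemma heis_lie12 : lie (heis_x 0) (heis_x 1) = heis_x 2.
Proof.
rewrite -[LHS]/(heis_lie _ _) /heis_lie !heis_co_x /=.
by rewrite mulr1 mul0r subr0 scale1r.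
Qed.

Lemma heis_lie13 : lie (heis_x 0) (heis_x 2) = 0.
Proof.
rewrite -[LHS]/(heis_lie _ _) /heis_lie !heis_co_x /=.
by rewrite !mulr0 subr0 scale0r.
Qed.

Lemma heis_lie23 : lie (heis_x 1) (heis_x 2) = 0.
Proof.
rewrite -[LHS]/(heis_lie _ _) /heis_lie !heis_co_x /=.
by rewrite !mulr0 subr0 scale0r.
Qed.

Lemma heis_ppow1 : ppow (heis_x 0) = c *: heis_x 2.
Proof.
rewrite -[LHS]/(heis_ppow _) /heis_ppow heis_co_x /=.
by rewrite expr1n mulr1.
Qed.

Lemma heis_ppow2 : ppow (heis_x 1) = 0.
Proof.
rewrite -[LHS]/(heis_ppow _) /heis_ppow heis_co_x /= expr0n.
by rewrite gtn_eqF ?mulr0 ?scale0r // ltnW // ltnW.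
Qed.

Lemma heis_ppow3 : ppow (heis_x 2) = 0.
Proof.
rewrite -[LHS]/(heis_ppow _) /heis_ppow heis_co_x /= expr0n.
by rewrite gtn_eqF ?mulr0 ?scale0r // ltnW // ltnW.
Qed.

End Heisenberg.

(* Main.v *)
(** Mutually inverse substitutions of the variables that carry each generator
    of one ideal into the other ideal induce an isomorphism of the quotients.
    For C5 and C6 the identity substitution works; for C15 it is
    [e = x], [f = - 2 y], [h = - 2 z]. The brackets of basis vectors in the
    wrong order add nothing to the ideal of relations, by antisymmetry. *)
From HB Require Import structures.
Require Import Defs.
From mathcomp Require Import all_boot all_order all_algebra.
From mathcomp Require Import monalg.

Set Implicit Arguments.
Unset Strict Implicit.
Unset Printing Implicit Defensive.

Import GRing.Theory.
Local Open Scope ring_scope.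

(** * Ideals and isomorphisms of quotient algebras *)

Section QuotientIsomorphism.
Variables (k : fieldType) (A B : algType k) (S : seq A) (T : seq B).

Lemma in_idealZ (c : k) a : in_ideal S a -> in_ideal S (c *: a).
Proof. by move=> Sa; rewrite -mulr_algl; apply: ideal_mull. Qed.

Lemma in_idealN a : in_ideal S a -> in_ideal S (- a).
Proof. by rewrite -scaleN1r; apply: in_idealZ. Qed.

(** Induction on the derivation of membership: each closure rule of an ideal is carried by [phi] to
    the same rule in the target. *)
Lemma in_ideal_morph (phi : {lrmorphism A -> B}) :
  (forall s, s \in S -> in_ideal T (phi s)) ->
  forall a, in_ideal S a -> in_ideal T (phi a).
Proof.
move=> phiS a; elim=> [s /phiS //||||].
- by rewrite raddf0; apply: ideal_zero.
- by move=> b c _ IHb _ IHc; rewrite raddfD; apply: ideal_add.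
- by move=> b c _ IHc; rewrite rmorphM; apply: ideal_mull.
- by move=> b c _ IHb; rewrite rmorphM; apply: ideal_mulr.
Qed.

End QuotientIsomorphism.

Lemma quot_alg_iso (k : fieldType) (A B : algType k) (S : seq A) (T : seq B)
    (phi : {lrmorphism A -> B}) (psi : {lrmorphism B -> A}) :
  cancel phi psi -> cancel psi phi ->
  (forall s, s \in S -> in_ideal T (phi s)) ->
  (forall t, t \in T -> in_ideal S (psi t)) ->
  quot_alg S \isoalg quot_alg T.
Proof.
move=> phiK psiK phiS psiT.
pose f (u : quot_alg S) : quot_alg T := quot_pi T (phi (repr u)).
pose g (v : quot_alg T) : quot_alg S := quot_pi S (psi (repr v)).
(* [f] uses a chosen representative; any other differs from it by an element of the ideal of [S],
   which [phi] sends into the ideal of [T]. *)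
have fE a : f (quot_pi S a) = quot_pi T (phi a).
  apply/quot_piP; rewrite -raddfB; apply: in_ideal_morph phiS _ _.
  by apply/quot_piP; rewrite /quot_pi reprK.
have gE b : g (quot_pi T b) = quot_pi S (psi b).
  apply/quot_piP; rewrite -raddfB; apply: in_ideal_morph psiT _ _.
  by apply/quot_piP; rewrite /quot_pi reprK.
exists f; split; last first.
- exists g => [u|v].
    by have [a ->] := quot_pi_surj u; rewrite fE gE phiK.
  by have [b ->] := quot_pi_surj v; rewrite gE fE psiK.
- split=> [|u v]; first by rewrite -(rmorph1 (quot_pi S)) fE !rmorph1.
  have [a ->] := quot_pi_surj u; have [b ->] := quot_pi_surj v.
  by rewrite -rmorphM !fE !rmorphM.
move=> c u v; have [a ->] := quot_pi_surj u; have [b ->] := quot_pi_surj v.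
by rewrite -linearP !fE !linearP.
Qed.

(** * Universal property of the free algebra *)

Section FreeAlgebraLift.
Variables (k : fieldType) (n : nat) (A : algType k) (v : 'I_n -> A).

Definition word_eval (w : word n) : A := \prod_(i <- w) v i.

Fact word_eval_mmorphism : mmorphism word_eval.
Proof. by split=> [w1 w2|]; rewrite /word_eval ?big_nil ?big_cat. Qed.

HB.instance Definition _ :=
  monalg.isMultiplicative.Build (word n) A word_eval word_eval_mmorphism.

Definition freealg_lift (a : freealg k n) : A := mmap (in_alg A) word_eval a.

Fact freealg_lift_linear : linear freealg_lift.
Proof.
by move=> c a b; rewrite /freealg_lift mmapD mmapZ mulr_algl.
Qed.

(** [A] may be noncommutative; evaluation is multiplicative because the coefficients land among the
    scalars of [A], which commute with the value of every word. *)
Fact freealg_lift_monoid_morphism : monoid_morphism freealg_lift.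
Proof.
have comm_eval (g : {malg k[word n]}) m m' :
    GRing.comm (in_alg A g@_m) (word_eval m').
  by rewrite /GRing.comm mulr_algl mulr_algr.
by have [evM ev1] := commr_mmap_is_multiplicative comm_eval; split.
Qed.

HB.instance Definition _ := GRing.isLinear.Build k (freealg k n) A _
  freealg_lift freealg_lift_linear.
HB.instance Definition _ := GRing.isMonoidMorphism.Build (freealg k n) A
  freealg_lift freealg_lift_monoid_morphism.

Lemma freealg_lift_var i : freealg_lift (freevar i) = v i.
Proof.
by rewrite /freealg_lift /freevar mmapU mulr_algl scale1r /word_eval big_seq1.
Qed.

End FreeAlgebraLift.

(** Words span the free algebra and are products of variables. *)
Lemma freealg_morph_id (k : fieldType) n
    (f : {lrmorphism freealg k n -> freealg k n}) :
  (forall i, f (freevar i) = freevar i) -> f =1 id.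
Proof.
move=> f_var a; rewrite [a]monalgE raddf_sum; apply: eq_bigr => w _ /=.
have wU (c : k) (u : word n) : << c *g u >> = c *: (<< u >> : freealg k n).
  by apply/malgP => m; rewrite mcoeffZ !mcoeffU mulr_natr.
rewrite wU linearZ; congr (_ *: _); elim: w => [|i w IHw].
  exact: rmorph1.
have -> : << (i :: w : word n) >> = freevar i * << w >> :> freealg k n.
  by rewrite malgM_def fgmulUU mulr1.
by rewrite rmorphM /= f_var IHw.
Qed.

Lemma ord3_ind (P : 'I_3 -> Prop) : P 0 -> P 1 -> P 2%:R -> forall i, P i.
Proof.
move=> P0 P1 P2 [[|[|[|//]]] lti].
- by rewrite (_ : Ordinal lti = 0) //; apply: val_inj.
- by rewrite (_ : Ordinal lti = 1) //; apply: val_inj.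
- by rewrite (_ : Ordinal lti = 2%:R) //; apply: val_inj.
Qed.

Lemma acommC (A : pzRingType) (u v : A) : acomm v u = - acomm u v.
Proof. by rewrite /acomm opprB. Qed.

Lemma forall_mem6 (T : eqType) (P : T -> Prop) s0 s1 s2 s3 s4 s5 :
  P s0 -> P s1 -> P s2 -> P s3 -> P s4 -> P s5 ->
  forall s, s \in [:: s0; s1; s2; s3; s4; s5] -> P s.
Proof.
move=> P0 P1 P2 P3 P4 P5 s; rewrite !inE.
by case/or4P=> [||| /or3P[]] /eqP ->.
Qed.

(** * Relations of the restricted enveloping algebra *)

Section EnvelopingRelations.
Variables (p : nat) (k : fieldType) (L : restrictedLieType p k).

Section AnyDimension.
Variables (n : nat) (X : n.-tuple L).

Fact env_lin_linear : linear (env_lin X).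
Proof.
move=> c u v; rewrite /env_lin scaler_sumr -big_split /=.
by apply: eq_bigr => i _; rewrite linearP scalerDl scalerA.
Qed.

HB.instance Definition _ := GRing.isLinear.Build k L (freealg k n) _
  (env_lin X) env_lin_linear.

(** The coordinates are dual to the basis, so the sum keeps a single term. *)
Lemma env_lin_tnth i : basis_of fullv X -> env_lin X (tnth X i) = freevar i.
Proof.
move=> /basis_free freeX; rewrite /env_lin (bigD1 i) //= (tnth_nth 0).
rewrite coord_free // eqxx scale1r big1 ?addr0 // => j ne_ji.
by rewrite coord_free // eq_sym (negPf ne_ji) scale0r.
Qed.

(** Convertible to an entry of [env_rels], but phrased with [acomm] to match the presentations. *)
Definition env_comm i j : freealg k n :=
  acomm (freevar i) (freevar j) - env_lin X (lie (tnth X i) (tnth X j)).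

Definition env_ppow i : freealg k n :=
  freevar i ^+ p - env_lin X (ppow (tnth X i)).

Lemma env_comm_in i j : in_ideal (env_rels X) (env_comm i j).
Proof.
apply: ideal_gen; rewrite mem_cat; apply/orP; left.
by apply/allpairsP; exists (i, j); rewrite !mem_enum.
Qed.

Lemma env_ppow_in i : in_ideal (env_rels X) (env_ppow i).
Proof.
apply: ideal_gen; rewrite mem_cat; apply/orP; right.
by apply/mapP; exists i; rewrite ?mem_enum.
Qed.

(** Polarization of [liexx] at [u + v]. *)
Lemma liexN (u v : L) : lie v u = - lie u v.
Proof.
apply/eqP; rewrite -addr_eq0; apply/eqP; have := liexx (u + v).
have addl x y z : lie (x + y) z = lie x z + lie y z :> L.
  by have := lie_linearl z 1 x y; rewrite !scale1r.
have addr x y z : lie x (y + z) = lie x y + lie x z :> L.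
  by have := lie_linearr x 1 y z; rewrite !scale1r.
by rewrite addl !addr !liexx add0r addr0 addrC.
Qed.

Lemma env_commii i : env_comm i i = 0.
Proof. by rewrite /env_comm liexx raddf0 /acomm !subrr. Qed.

Lemma env_commC i j : env_comm j i = - env_comm i j.
Proof. by rewrite /env_comm liexN raddfN acommC -opprD. Qed.

End AnyDimension.

(** Reduces twelve generators to six: the diagonal commutator relations vanish, and exchanging the
    indices of the others only changes the sign. *)
Lemma env_rels3_morph (X : 3.-tuple L) (B : algType k) (T : seq B)
    (phi : {lrmorphism freealg k 3 -> B}) :
  in_ideal T (phi (env_comm X 0 1)) ->
  in_ideal T (phi (env_comm X 0 2)) ->
  in_ideal T (phi (env_comm X 1 2)) ->
  in_ideal T (phi (env_ppow X 0)) ->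
  in_ideal T (phi (env_ppow X 1)) ->
  in_ideal T (phi (env_ppow X 2)) ->
  forall s, s \in env_rels X -> in_ideal T (phi s).
Proof.
move=> T01 T02 T12 Tp0 Tp1 Tp2 s.
rewrite mem_cat => /orP[|/mapP[i _ ->]]; last first.
  change (in_ideal T (phi (env_ppow X i))).
  by elim/ord3_ind: i; [exact: Tp0|exact: Tp1|exact: Tp2].
case/allpairsP => -[i j] [_ _ ->] /=.
change (in_ideal T (phi (env_comm X i j))).
have TC i' j' : in_ideal T (phi (env_comm X i' j')) ->
    in_ideal T (phi (env_comm X j' i')).
  by move=> Tij; rewrite env_commC raddfN; apply: in_idealN.
have Tii i' : in_ideal T (phi (env_comm X i' i')).
  by rewrite env_commii raddf0; apply: ideal_zero.
elim/ord3_ind: i; elim/ord3_ind: j;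
  [exact: Tii|exact: T01|exact: T02|exact: TC T01|exact: Tii|exact: T12
  |exact: TC T02|exact: TC T12|exact: Tii].
Qed.

End EnvelopingRelations.

(** * Commutators and powers under scaling and morphisms *)

Lemma acommZ (k : fieldType) (A : algType k) (a b : k) (u v : A) :
  acomm (a *: u) (b *: v) = (a * b) *: acomm u v.
Proof.
by rewrite /acomm -!scalerAl -!scalerAr !scalerA (mulrC b a) scalerBr.
Qed.

Lemma acommZr (k : fieldType) (A : algType k) (b : k) (u v : A) :
  acomm u (b *: v) = b *: acomm u v.
Proof. by rewrite -[u in LHS]scale1r acommZ mul1r. Qed.

Lemma rmorph_acomm (A B : pzRingType) (f : {rmorphism A -> B}) (u v : A) :
  f (acomm u v) = acomm (f u) (f v).
Proof. by rewrite /acomm rmorphB !rmorphM. Qed.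

Lemma lrmorphXn (k : fieldType) (A B : algType k) (f : {lrmorphism A -> B}) n u :
  f (u ^+ n) = f u ^+ n.
Proof. exact: rmorphXn. Qed.

(** * The Heisenberg algebras, for [C5] and [C6] *)

Section HeisenbergPresentation.
Variables (p : nat) (k : fieldType) (L : restrictedLieType p k).
Variables (x1 x2 x3 : L) (c : k).
Hypothesis basisX : basis_of fullv [tuple x1; x2; x3].
Hypotheses (lie12 : lie x1 x2 = x3) (lie13 : lie x1 x3 = 0).
Hypotheses (lie23 : lie x2 x3 = 0).
Hypotheses (ppow1 : ppow x1 = c *: x3) (ppow2 : ppow x2 = 0).
Hypotheses (ppow3 : ppow x3 = 0).

Let x : freealg k 3 := freevar 0.
Let y : freealg k 3 := freevar 1.
Let z : freealg k 3 := freevar 2.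
Let X := [tuple x1; x2; x3].
Let S := [:: acomm x y - z; acomm x z; acomm y z;
             x ^+ p - c *: z; y ^+ p; z ^+ p].

(** The scalar [c] treats [C5] ([c = 0]) and [C6] ([c = 1]) together. The entries of [S] are exactly
    the six relations to which [env_rels3_morph] reduces. *)
Lemma heis_presentation_iso : quot_alg S \isoalg res_env X.
Proof.
have linX3 : env_lin X x3 = z by exact: (env_lin_tnth 2 basisX).
have E01 : env_comm X 0 1 = acomm x y - z.
  (* The pattern selects the bracket of [tnth X 0] and [tnth X 1], which compute to [x1] and
     [x2]. *)
  rewrite /env_comm [lie _ _]lie12 linX3; reflexivity.
have E02 : env_comm X 0 2 = acomm x z.
  rewrite /env_comm [lie _ _]lie13 raddf0 subr0; reflexivity.
have E12 : env_comm X 1 2 = acomm y z.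
  rewrite /env_comm [lie _ _]lie23 raddf0 subr0; reflexivity.
have P0 : env_ppow X 0 = x ^+ p - c *: z.
  rewrite /env_ppow [ppow _]ppow1 linearZ /= linX3; reflexivity.
have P1 : env_ppow X 1 = y ^+ p.
  rewrite /env_ppow [ppow _]ppow2 raddf0 subr0; reflexivity.
have P2 : env_ppow X 2 = z ^+ p.
  rewrite /env_ppow [ppow _]ppow3 raddf0 subr0; reflexivity.
have S_gen i : (i < 6)%N -> in_ideal S S`_i.
  by move=> lti; apply: ideal_gen; apply: mem_nth.
apply: (@quot_alg_iso _ _ _ _ _ idfun idfun) => [//|//||].
  apply: forall_mem6.
  - rewrite -E01; exact: env_comm_in.
  - rewrite -E02; exact: env_comm_in.
  - rewrite -E12; exact: env_comm_in.
  - rewrite -P0; exact: env_ppow_in.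
  - rewrite -P1; exact: env_ppow_in.
  - rewrite -P2; exact: env_ppow_in.
apply: (@env_rels3_morph _ _ _ X _ S idfun).
- rewrite E01; exact: (S_gen 0).
- rewrite E02; exact: (S_gen 1).
- rewrite E12; exact: (S_gen 2).
- rewrite P0; exact: (S_gen 3).
- rewrite P1; exact: (S_gen 4).
- rewrite P2; exact: (S_gen 5).
Qed.

End HeisenbergPresentation.

(** * The algebra [sl2], for [C15] *)

Section SL2Presentation.
Variables (p : nat) (k : fieldType) (chk : p \in [pchar k]).
Hypothesis p_gt2 : (2 < p)%N.

(* In [res_env X] the variables [x, y, z] stand for [e, h, f]. *)
Let x : freealg k 3 := freevar 0.
Let y : freealg k 3 := freevar 1.
Let z : freealg k 3 := freevar 2.
Let X := [tuple sl2_e chk; sl2_h chk; sl2_f chk].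
Let S := [:: acomm x y - z; acomm x z - x; acomm y z + y;
             x ^+ p; y ^+ p; z ^+ p - z].

(** With [e = x], the relation [[z, x] = - x] of [C15] and [[h, e] = 2 e] suggest [h = - 2 z]; then
    [[e, f] = h] and [[x, y] = z] give [f = - 2 y]. *)
Let a : k := - 2%:R.

(** A prime [p > 2] does not divide [2], so rescaling by [a] is invertible. *)
Lemma opp_two_neq0 : a != 0.
Proof.
rewrite oppr_eq0 -(dvdn_pcharf chk); apply/negP => /(dvdn_leq (isT : 0 < 2)%N).
by rewrite leqNgt p_gt2.
Qed.

(** Frobenius respects opposites and fixes the images of natural numbers. *)
Lemma opp_two_expp : a ^+ p = a.
Proof.
by rewrite -!(pFrobenius_autE chk) pFrobenius_autN pFrobenius_aut_nat.
Qed.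

(** The swap is needed because [h] is the third variable of [C15] but the second vector of [X].
    Taking [c] to be [a] or its inverse gives the two directions. *)
Definition swap_rescale (c : k) : freealg k 3 -> freealg k 3 :=
  freealg_lift (fun i : 'I_3 =>
    if i == 0 then x else c *: (if i == 1 then z else y)).

HB.instance Definition _ c := GRing.LRMorphism.on (swap_rescale c).

Lemma swap_rescale_x c : swap_rescale c x = x.
Proof. exact: freealg_lift_var. Qed.

Lemma swap_rescale_y c : swap_rescale c y = c *: z.
Proof. exact: freealg_lift_var. Qed.

Lemma swap_rescale_z c : swap_rescale c z = c *: y.
Proof. exact: freealg_lift_var. Qed.

Lemma swap_rescaleK c d : c * d = 1 ->
  cancel (swap_rescale c) (swap_rescale d).
Proof.
move=> cd1; apply: (@freealg_morph_id _ _ (swap_rescale d \o swap_rescale c)).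
elim/ord3_ind => /=.
- exact: etrans (congr1 _ (swap_rescale_x c)) (swap_rescale_x d).
- apply: etrans (congr1 _ (swap_rescale_y c)) _.
  rewrite linearZ /= swap_rescale_z scalerA cd1; exact: scale1r.
- apply: etrans (congr1 _ (swap_rescale_z c)) _.
  rewrite linearZ /= swap_rescale_y scalerA cd1; exact: scale1r.
Qed.

(* Rescaling preserves the relation [h ^ p = h] because [- 2] lies in the prime
   field. *)
Lemma sl2_presentation_iso : quot_alg S \isoalg res_env X.
Proof.
have basisX : basis_of fullv X := sl2_basisP chk.
have lin0 : env_lin X (sl2_e chk) = x by exact: (env_lin_tnth 0 basisX).
have lin1 : env_lin X (sl2_h chk) = y by exact: (env_lin_tnth 1 basisX).
have lin2 : env_lin X (sl2_f chk) = z by exact: (env_lin_tnth 2 basisX).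
(* [X] lists [e] before [h], so the bracket is [[e, h] = - [h, e] = - 2 e]. *)
have E01 : env_comm X 0 1 = acomm x y - a *: x.
  rewrite /env_comm liexN [lie _ _](sl2_he chk).
  rewrite -scaleNr linearZ /= lin0; reflexivity.
have E02 : env_comm X 0 2 = acomm x z - y.
  rewrite /env_comm [lie _ _](sl2_ef chk) lin1; reflexivity.
have E12 : env_comm X 1 2 = acomm y z - a *: z.
  rewrite /env_comm [lie _ _](sl2_hf chk) linearZ /= lin2; reflexivity.
have P0 : env_ppow X 0 = x ^+ p.
  rewrite /env_ppow [ppow _](sl2_e_ppow chk) raddf0 subr0; reflexivity.
have P1 : env_ppow X 1 = y ^+ p - y.
  rewrite /env_ppow [ppow _](sl2_h_ppow chk) lin1; reflexivity.
have P2 : env_ppow X 2 = z ^+ p.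
  rewrite /env_ppow [ppow _](sl2_f_ppow chk) raddf0 subr0; reflexivity.
have S_gen i : (i < 6)%N -> in_ideal S S`_i.
  by move=> lti; apply: ideal_gen; apply: mem_nth.
have a_neq0 := opp_two_neq0.
have aVa : a^-1 * a = 1 := mulVf a_neq0.
have aaV : a * a^-1 = 1 := mulfV a_neq0.
have aVp : a^-1 ^+ p = a^-1 by rewrite exprVn opp_two_expp.
(* Solving [h = - 2 z] and [f = - 2 y] for [z] and [y] puts [a^-1] in the map out of [C15], and [a]
   in its inverse. *)
apply: (quot_alg_iso (swap_rescaleK aVa) (swap_rescaleK aaV)).
  apply: forall_mem6.
  - rewrite raddfB /= rmorph_acomm /= swap_rescale_x swap_rescale_y swap_rescale_z.
    rewrite acommZr -scalerBr -E02; exact/in_idealZ/env_comm_in.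
  - rewrite raddfB /= rmorph_acomm /= swap_rescale_x swap_rescale_z acommZr.
    rewrite -[X in _ - X]scale1r -aVa -scalerA -scalerBr -E01.
    exact/in_idealZ/env_comm_in.
  - rewrite raddfD /= rmorph_acomm /= swap_rescale_y swap_rescale_z acommZ.
    (* The swap reverses the commutator; writing [a^-1] as [a^-1 * a^-1 * a] exhibits the image as
       [- (a^-1 * a^-1)] times [[y, z] - a z]. *)
    rewrite acommC scalerN -scaleNr -[X in X *: z]mulr1 -aVa mulrA -scalerA.
    rewrite -[X in _ + X]opprK -scaleNr -scalerBr -E12.
    exact/in_idealZ/env_comm_in.
  - rewrite lrmorphXn /= swap_rescale_x -P0; exact: env_ppow_in.
  - rewrite lrmorphXn /= swap_rescale_y exprZn -P2; exact/in_idealZ/env_ppow_in.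
  - rewrite raddfB /= lrmorphXn /= swap_rescale_z exprZn aVp -scalerBr -P1.
    exact/in_idealZ/env_ppow_in.
(* The swap also permutes the relations: up to a scalar, they go in order to the entries 1, 0, 2, 3,
   5, 4 of [S]. *)
apply: env_rels3_morph.
- rewrite E01 raddfB /= linearZ /= rmorph_acomm /= swap_rescale_x swap_rescale_y.
  rewrite acommZr -scalerBr; apply: in_idealZ; exact: (S_gen 1).
- rewrite E02 raddfB /= rmorph_acomm /= swap_rescale_x swap_rescale_y swap_rescale_z.
  rewrite acommZr -scalerBr; apply: in_idealZ; exact: (S_gen 0).
- rewrite E12 raddfB /= linearZ /= rmorph_acomm /= swap_rescale_y swap_rescale_z.
  rewrite acommZ acommC scalerN scalerA -opprD -scalerDr.
  apply/in_idealN/in_idealZ; exact: (S_gen 2).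
- rewrite P0 rmorphXn /= swap_rescale_x; exact: (S_gen 3).
- rewrite P1 raddfB /= lrmorphXn /= swap_rescale_y exprZn opp_two_expp -scalerBr.
  apply: in_idealZ; exact: (S_gen 5).
- rewrite P2 rmorphXn /= swap_rescale_z exprZn.
  apply: in_idealZ; exact: (S_gen 4).
Qed.

End SL2Presentation.

Theorem proposition6p1 (p : nat) (k : fieldType)
    (pr_p : prime p) (p_gt2 : (2 < p)%N) (chk : p \in [pchar k]) :
  [/\ (* (a) *)
      forall (L : restrictedLieType p k) (x1 x2 x3 : L),
        basis_of fullv [tuple x1; x2; x3] ->
        lie x1 x2 = x3 -> lie x1 x3 = 0 -> lie x2 x3 = 0 ->
        ppow x1 = 0 -> ppow x2 = 0 -> ppow x3 = 0 ->
        C5 p k \isoalg res_env [tuple x1; x2; x3],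
      (* (b) *)
      forall (L : restrictedLieType p k) (x1 x2 x3 : L),
        basis_of fullv [tuple x1; x2; x3] ->
        lie x1 x2 = x3 -> lie x1 x3 = 0 -> lie x2 x3 = 0 ->
        ppow x1 = x3 -> ppow x2 = 0 -> ppow x3 = 0 ->
        C6 p k \isoalg res_env [tuple x1; x2; x3]
    & (* (c) *)
      C15 p k \isoalg
        res_env [tuple sl2_e chk; sl2_h chk; sl2_f chk]].
Proof.
split=> [L x1 x2 x3 bX l12 l13 l23 p1|L x1 x2 x3 bX l12 l13 l23 p1|].
- move=> p2 p3.
  have p1' : ppow x1 = 0 *: x3 by rewrite scale0r.
  have := heis_presentation_iso bX l12 l13 l23 p1' p2 p3.
  by rewrite scale0r subr0.
- move=> p2 p3.
  have p1' : ppow x1 = 1 *: x3 by rewrite scale1r.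
  have := heis_presentation_iso bX l12 l13 l23 p1' p2 p3.
  by rewrite scale1r.
exact: sl2_presentation_iso.
Qed.
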